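(* Let $\Omega$ be a convex set in a real locally convex topological vector space $X$. Given $x^*\in X^*$ and $b\in\mathbb{R}$, define $f\colon X\to(-\infty,\infty]$ by $f(x):=\langle x^*,x\rangle+b$ if $x\in\Omega$ and $f(x):=\infty$ if $x\notin\Omega$. Then $$\operatorname{qri}\big(\operatorname{epi}(f)\big)=\big\{(x,\lambda)\in X\times\mathbb{R}\;\big|\;x\in\operatorname{qri}(\Omega),\;\lambda>f(x)\big\}.$$
   Context: $X^*$ denotes the topological dual of $X$ and $\langle x^*,x\rangle:=x^*(x)$. For a nonempty subset $A$ of a real locally convex topological vector space $Z$, $\operatorname{cone}(A):=\{ta\mid t\ge 0,\ a\in A\}$ and $\overline{\operatorname{cone}}(A)$ is its closure. For a nonempty convex set $C\subset Z$, the quasi-relative interior is $\operatorname{qri}(C):=\{x\in C\mid \overline{\operatorname{cone}}(C-x)\text{ is a linear subspace of }Z\}$; by convention $\operatorname{qri}(\emptyset)=\emptyset$. For $f\colon X\to(-\infty,\infty]$, $\operatorname{epi}(f):=\{(x,\alpha)\in X\times\mathbb{R}\mid \alpha\ge f(x)\}$. *)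

(* Defs.v *)
From HB Require Import structures.
From mathcomp Require Import all_boot all_order all_algebra.
From mathcomp Require Import all_classical all_reals all_analysis.

Set Implicit Arguments.
Unset Strict Implicit.
Unset Printing Implicit Defensive.

Import Order.TTheory GRing.Theory Num.Theory.
Import numFieldNormedType.Exports.

Local Open Scope classical_set_scope.
Local Open Scope ring_scope.

Definition cone (R : realType) (E : lmodType R) (A : set E) : set E :=
  [set t *: a | t in [set t : R | 0 <= t] & a in A].

Definition linear_subspace (R : realType) (E : lmodType R) (L : set E) : Prop :=
  submod_closed [in L].

(* Membership in C is part of the definition, so qri set0 = set0. *)
Definition qri (R : realType) (E : tvsType R) (C : set E) : set E :=
  [set x | C x /\ linear_subspace (closure (cone [set y - x | y in C]))].

(* The real factor is R^o so that X * R^o carries the product vector space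
   structure and the product topology. *)
Definition epi (R : realType) (X : tvsType R) (f : X -> \bar R) :
    set (X * R^o) :=
  [set z | (f z.1 <= (z.2)%:E)%E].

Definition affine_on (R : realType) (X : tvsType R) (Omega : set X)
    (xs : X -> R^o) (b : R) : X -> \bar R :=
  fun x => if x \in Omega then (xs x + b)%:E else +oo%E.

(* Main.v *)
(** Fix x0 in Omega and lam > f x0. Since Omega - x0 is convex and contains 0,
    a point t v of cone (Omega - x0) is also T (t/T v) for every T >= t, and
    for T large the constraint defining epi f becomes vacuous; hence
    cone (epi f - (x0, lam)) = cone (Omega - x0) x R, and the closure of this
    product is a subspace iff that of its first factor is. If lam = f x0, the
    cone contains (0, 1) but lies in the closed half-space
    {(u, s) | xs u <= s}, so its closure is not a subspace. *)
Require Import Defs.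
From HB Require Import structures.
From mathcomp Require Import all_boot all_order all_algebra.
From mathcomp Require Import all_classical all_reals all_analysis.
From mathcomp Require Import lra.

Set Implicit Arguments.
Unset Strict Implicit.
Unset Printing Implicit Defensive.

Import Order.TTheory GRing.Theory Num.Theory.
Import numFieldNormedType.Exports.

Local Open Scope classical_set_scope.
Local Open Scope ring_scope.

(** One inclusion is continuity of [fst]; for the other, a product neighbourhood of [(x, y)] meets
    the set at a point that keeps [y]. *)
Lemma closure_setXT (S T : topologicalType) (A : set S) :
  closure (A `*` [set: T]) = closure A `*` [set: T].
Proof.
apply/seteqP; split => -[x y].
  move=> Axy; split => // B xB.
  have [|[a b] [[Aa _] Bab]] := Axy (fst @^-1` B); first exact: cvg_fst.
  by exists a.
move=> [Ax _] B [[P Q] /= [xP yQ] PQB].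
have [a [Aa Pa]] := Ax _ xP.
exists (a, y); split => //.
by apply: PQB; split => //=; exact: nbhs_singleton.
Qed.

Lemma linear_subspaceXT (R : realType) (E F : lmodType R) (L : set E) :
  linear_subspace (L `*` [set: F]) <-> linear_subspace L.
Proof.
split => -[L0 LD]; split.
- by move: L0; rewrite !inE => -[].
- move=> a u v; rewrite !inE => Lu Lv.
  (* The second coordinate is unconstrained, so padding with 0 suffices. *)
  have := LD a (u, 0) (v, 0); rewrite !inE => /(_ _ _)[] //.
- by move: L0; rewrite !inE.
- move=> a u v; rewrite !inE => -[Lu _] [Lv _]; split => //=.
  by have := LD a u.1 v.1; rewrite !inE; apply.
Qed.

Lemma linear_subspaceN (R : realType) (E : lmodType R) (L : set E) (x : E) :
  linear_subspace L -> L x -> L (- x).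
Proof.
move=> [L0 LD] Lx; have := LD (- 1) x 0.
by rewrite !inE scaleN1r addr0; apply => //; move: L0; rewrite inE.
Qed.

Lemma convex_set_segment (R : realType) (E : lmodType R) (C : set E)
    (x y : E) (s : R) :
  convex_set (C : set (convex_lmodType E)) -> C x -> C y -> 0 <= s <= 1 ->
  C (x + s *: (y - x)).
Proof.
move=> Cconv Cx Cy /andP[s0 s1].
(* [y] comes first because [conv] puts the weight [s] on its first point. *)
have := Cconv y x (Itv01 s0 s1); rewrite !inE => /(_ Cy Cx).
rewrite [conv _ _ _](_ : _ = x + s *: (y - x)) //.
by rewrite [LHS]/(s *: y + (1 - s) *: x) scalerBl scale1r scalerBr addrCA.
Qed.

Section EpiAffine.
Context (R : realType) (X : tvsType R) (Omega : set X).
Context (xs : {linear X -> R^o}) (b : R).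
Let f := affine_on Omega xs b.

Lemma epi_affineE (x : X) (l : R^o) :
  epi f (x, l) <-> Omega x /\ xs x + b <= l.
Proof.
rewrite /epi /f /affine_on /=; case: ifPn => [|].
  by rewrite inE lee_fin => Ox; split => [|[]].
by rewrite notin_setE leye_eq => Ox; split => [//|[]].
Qed.

Lemma affine_ltE (x : X) (l : R) : Omega x -> (f x < l%:E)%E = (xs x + b < l).
Proof. by move=> Ox; rewrite /f /affine_on mem_set // lte_fin. Qed.

Lemma cone_epi_affine (x0 : X) (l0 : R^o) :
  convex_set (Omega : set (convex_lmodType X)) ->
  Omega x0 -> xs x0 + b < l0 ->
  cone [set z - (x0, l0) | z in epi f] =
  cone [set x - x0 | x in Omega] `*` setT.
Proof.
move=> Oconv Ox0 lt0; apply/seteqP; split.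
  move=> _ [t t0 [_ [[x l] /epi_affineE [Ox _] <-] <-]].
  by split => //; exists t => //; exists (x - x0) => //; exists x.
move=> [_ s] [/= [t /= t0 [_ [x Ox <-] <-]] _].
(* Moving [(x0, l0)] by [1 / T] times [(t *: (x - x0), s)] preserves the epigraph inequality exactly
   when [d / T <= c]. In [T], the summand [1] gives positivity, [t] gives [t / T <= 1], and the last
   one gives [d / T <= c]. *)
pose c := l0 - (xs x0 + b); have c0 : 0 < c by rewrite subr_gt0.
pose d := t * xs (x - x0) - s.
pose T := 1 + t + `|d| / c.
have dc0 : 0 <= `|d| / c by rewrite divr_ge0 // ltW.
have T0 : 0 < T by rewrite /T; lra.
exists T; first exact: ltW.
exists ((t / T) *: (x - x0), s / T); last first.
  congr (_, _); first by rewrite /= scalerA mulrC divfK // gt_eqF.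
  by rewrite /= [LHS]mulrC divfK // gt_eqF.
exists (x0 + (t / T) *: (x - x0), l0 + s / T); last first.
  by congr (_, _) => /=; rewrite addrAC subrr add0r.
apply/epi_affineE; split.
  apply: convex_set_segment => //.
  by rewrite divr_ge0 ?(ltW T0)//= ler_pdivrMr // mul1r /T; lra.
rewrite linearD linearZ /=.
have : d / T <= c.
  rewrite ler_pdivrMr // (le_trans (ler_norm _)) // /T mulrDr [c * (_ / _)]mulrC.
  by rewrite divfK ?gt_eqF // lerDr mulr_ge0 ?(ltW c0) //; lra.
rewrite /d /c mulrBl mulrAC.
set w := t / T * _; rewrite -[t / T *: _]/w; lra.
Qed.

(* On the graph of f the vertical direction is not reversible. *)
Lemma qri_epi_affine_lt (x0 : X) (l0 : R^o) :
  continuous xs -> qri (epi f) (x0, l0) -> xs x0 + b < l0.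
Proof.
move=> xs_cont [/epi_affineE [Ox0]]; rewrite le_eqVlt => /orP[/eqP l0E|//] Lsub.
pose H : set (X * R^o) := [set z | xs z.1 <= z.2].
have Hclosed : closed H.
  have -> : H = (fun z : X * R^o => z.2 - xs z.1 : R^o) @^-1` [set r | 0 <= r].
    by apply/seteqP; split => z; rewrite /H /= subr_ge0.
  apply: preimage_closed => [z _|]; last exact: closed_ge.
  apply: cvgB; first exact: cvg_snd.
  by apply: continuous_comp; [exact: cvg_fst|exact: xs_cont].
have subH : closure (cone [set z - (x0, l0) | z in epi f]) `<=` H.
  rewrite [H in _ `<=` H](closure_id _).1 //; apply: closureS.
  (* Subtracting [xs x0 + b = l0] from [xs x + b <= l] cancels [b] and leaves
     [xs (x - x0) <= l - l0]. *)
  move=> _ [t /= t0 [_ [[x l] /epi_affineE [_ xl] <-] <-]].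
  rewrite /H /= linearZ /= linearB /=.
  by apply: ler_wpM2l => //; rewrite -l0E; lra.
(* [(0, 1)] leads from [(x0, l0)] up to [(x0, l0 + 1)]; its opposite lying in [H] would mean
   [0 <= -1]. *)
have /(linear_subspaceN Lsub)/subH :
    closure (cone [set z - (x0, l0) | z in epi f]) (0, 1).
  apply: subset_closure; exists 1 => /=; first exact: ler01.
  exists (0, 1); last by rewrite scale1r.
  exists (x0, l0 + 1); first by apply/epi_affineE; split => //; lra.
  by congr (_, _) => /=; rewrite ?subrr // addrAC subrr add0r.
by rewrite /H /= oppr0 linear0 oppr_ge0 ler10.
Qed.

End EpiAffine.

Theorem proposition5p5 (R : realType) (X : tvsType R) (Omega : set X)
    (Omega_convex : convex_set (Omega : set (convex_lmodType X)))
    (xs : {linear X -> R^o}) (xs_continuous : continuous xs) (b : R) :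
  let f := affine_on Omega xs b in
  qri (epi f) =
  [set z : X * R^o | qri Omega z.1 /\ (f z.1 < (z.2)%:E)%E].
Proof.
move=> f; apply/seteqP; split => -[x0 l0] /=.
  (* Strictness comes first, since the product form of the cone is available only above the
     graph. *)
  move=> q; have lt0 := qri_epi_affine_lt xs_continuous q.
  case: q => /epi_affineE [Ox0 _].
  rewrite cone_epi_affine // closure_setXT => /linear_subspaceXT L.
  by rewrite affine_ltE.
move=> [[Ox0 L]]; rewrite affine_ltE // => lt0; split.
  by apply/epi_affineE; split => //; exact: ltW.
by rewrite cone_epi_affine // closure_setXT; apply/linear_subspaceXT.
Qed.
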